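(* Let $\mathbb{K}\in\{\mathbb{R},\mathbb{C}\}$ and let $(\Omega,\Sigma,\mu)$ be a semi-finite measure space. Then the following assertions hold for each measurable function $a:\Omega\to\mathbb{K}$, where $M_a$ is the multiplication operator on $\mathrm{L}_2(\Omega,\Sigma,\mu)$: a) $M_a$ is injective if and only if $\mu[a=0]=0$. In this case, $M_a^{-1}=M_{a^{-1}}$. b) $M_a$ is bounded if and only if $a\in\mathrm{L}_\infty(\Omega,\Sigma,\mu)$. In this case $\|M_a\|=\|a\|_{\mathrm{L}_\infty}$. c) $\sigma(M_a)=\sigma_{\mathrm{ap}}(M_a)=\mathrm{essran}(a)$, the essential range of $a$. d) If $\lambda\in\rho(M_a)$ then $R(\lambda,M_a)=M_{(\lambda-a)^{-1}}$. e) Up to equality $\mu$-almost everywhere, $a$ is uniquely determined by $M_a$. f) $M_a$ is symmetric if and only if it is self-adjoint if and only if $a\in\mathbb{R}$ almost everywhere.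
   Context: A measure space is semi-finite if each set of infinite measure has a subset of finite but non-zero measure. For measurable $a:\Omega\to\mathbb{K}$ the multiplication operator $M_a$ on $\mathrm{L}_2(\Omega,\Sigma,\mu)$ (scalar field $\mathbb{K}$) is $M_af:=af$ with $\mathrm{dom}(M_a):=\{f\in\mathrm{L}_2 : af\in\mathrm{L}_2\}$; it depends only on the class of $a$ modulo $\mu$-almost everywhere equality, and $M_a$ is also used when $a$ is only essentially measurable, i.e. defined almost everywhere and almost everywhere equal to a measurable function (so $M_{a^{-1}}$ makes sense if $a\neq0$ almost everywhere). $M_a$ ''bounded'' means that it is an everywhere defined bounded operator. $\sigma$, $\sigma_{\mathrm{ap}}$, $\rho$ denote spectrum, approximate point spectrum and resolvent set (subsets of $\mathbb{K}$); $R(\lambda,A):=(\lambda\mathrm{I}-A)^{-1}$. The essential range is $\mathrm{essran}(a):=\{\lambda\in\mathbb{K} : \mu[\,|a-\lambda|\le\varepsilon\,]>0\ \text{for all}\ \varepsilon>0\}$. $[\,\cdot\,]$ denotes the set of points of $\Omega$ where the condition holds. *)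

(* Defs.v *)
From HB Require Import structures.
From mathcomp Require Import all_boot all_order all_algebra.
From mathcomp Require Import all_classical all_reals all_analysis.
From mathcomp Require Import generic_quotient ring_quotient.
From mathcomp Require Import measurable_realfun lra.
From mathcomp.real_closed Require Import complex.

Set Implicit Arguments.
Unset Strict Implicit.
Unset Printing Implicit Defensive.
Import Order.TTheory GRing.Theory Num.Theory.
Import numFieldNormedType.Exports.
Local Open Scope classical_set_scope.
Local Open Scope ring_scope.

Variant RorC := RealField | ComplexField.

Definition scalar_field (R : realType) (k : RorC) : numFieldType :=
  match k with RealField => R | ComplexField => R[i] end.

Section Scalars.
Context {R : realType}.
Local Notation K k := (scalar_field R k).

Definition re {k} : K k -> R :=
  match k with RealField => id | ComplexField => @complex.Re R end.

Definition im {k} : K k -> R :=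
  match k with RealField => fun=> 0 | ComplexField => @complex.Im R end.

(* Only meaningful for [y = 0] over the reals. *)
Definition of_re_im {k} : R -> R -> K k :=
  match k with RealField => fun x _ => x | ComplexField => @Complex R end.

Definition conj {k} : K k -> K k :=
  match k with RealField => id | ComplexField => @conjc R end.

(* The norm of a [numFieldType] takes its values in the field itself; this is
   the same norm with values in [R]. *)
Definition rabs {k} (z : K k) : R := re `|z|.

Context {k : RorC}.
Implicit Types z w : K k.

Lemma re_of_re_im x y : re (of_re_im x y : K k) = x.
Proof. by case: k. Qed.

Lemma reD z w : re (z + w) = re z + re w.
Proof. by case: k z w => //= -[a b] [c e]. Qed.

Lemma imD z w : im (z + w) = im z + im w.
Proof. by case: k z w => /= [z w|[a b] [c e]]; rewrite ?addr0. Qed.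

Lemma reN z : re (- z) = - re z.
Proof. by case: k z => //= -[a b]. Qed.

Lemma imN z : im (- z) = - im z.
Proof. by case: k z => /= [z|[a b]]; rewrite ?oppr0. Qed.

Lemma re0 : re (0 : K k) = 0. Proof. by case: k. Qed.

Lemma im0 : im (0 : K k) = 0. Proof. by case: k. Qed.

Lemma reM z w : re (z * w) = re z * re w - im z * im w.
Proof. by case: k z w => /= [z w|[a b] [c e]]; rewrite ?mulr0 ?subr0. Qed.

Lemma imM z w : im (z * w) = re z * im w + im z * re w.
Proof. by case: k z w => /= [z w|[a b] [c e]]; rewrite ?mulr0 ?mul0r ?addr0. Qed.

Lemma rabsE z : rabs z = Num.sqrt (re z ^+ 2 + im z ^+ 2).
Proof.
by case: k z => /= [z|[a b]]; rewrite /rabs //= expr0n addr0 sqrtr_sqr.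
Qed.

Lemma normE z : `|z| = of_re_im (rabs z) 0.
Proof. by case: k z => /= [z|[a b]]. Qed.

Lemma rabs_ge0 z : 0 <= rabs z.
Proof. by rewrite rabsE sqrtr_ge0. Qed.

Lemma rabsD z w : rabs (z + w) <= rabs z + rabs w.
Proof.
rewrite /rabs; case: k z w => [z w|z w]; first exact: ler_normD.
by have := ler_normD z w; rewrite lecE /= => /andP[_]; case: z w => a b [].
Qed.

Lemma rabsM z w : rabs (z * w) = rabs z * rabs w.
Proof. by rewrite {1}/rabs normrM 2!normE reM 2!re_of_re_im; case: k z w => *; rewrite /= ?mul0r ?subr0. Qed.

Lemma rabs0 : rabs (0 : K k) = 0.
Proof. by rewrite /rabs normr0 re0. Qed.

Lemma rabs0_eq0 z : rabs z = 0 -> z = 0.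
Proof. by move=> z0; apply/eqP; rewrite -normr_eq0 normE z0; case: (k). Qed.

Lemma rabs_le_re_im z : rabs z <= `|re z| + `|im z|.
Proof.
rewrite rabsE -[leRHS]ger0_norm ?addr_ge0// -sqrtr_sqr ler_wsqrtr//.
rewrite sqrrD !real_normK ?num_real// [leRHS]addrAC lerDl.
by rewrite mulrn_wge0// mulr_ge0.
Qed.

Lemma re_le_rabs z : `|re z| <= rabs z.
Proof. by rewrite rabsE -sqrtr_sqr ler_wsqrtr// lerDl sqr_ge0. Qed.

Lemma im_le_rabs z : `|im z| <= rabs z.
Proof. by rewrite rabsE -sqrtr_sqr ler_wsqrtr// lerDr sqr_ge0. Qed.

Lemma ler_of_re_im x y : ((of_re_im x 0 : K k) <= of_re_im y 0) = (x <= y).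
Proof. by case: k => //=; rewrite lecE eqxx. Qed.

Lemma of_re_imD x y :
  (of_re_im (x + y) 0 : K k) = of_re_im x 0 + of_re_im y 0.
Proof. by case: k => //=; apply/eqP; rewrite eq_complex /= addr0 !eqxx. Qed.

Lemma of_re_imM x y :
  (of_re_im (x * y) 0 : K k) = of_re_im x 0 * of_re_im y 0.
Proof.
by case: k => //=; apply/eqP; rewrite eq_complex /= !mul0r mulr0 subr0 addr0 !eqxx.
Qed.

Lemma gt0_of_re_im (e : K k) : 0 < e -> exists2 r : R, 0 < r & e = of_re_im r 0.
Proof.
case: k e => [e e0|[a b]]; first by exists e.
by rewrite ltcE /= => /andP[/eqP -> a0]; exists a.
Qed.

Lemma lt_of_re_im x y : ((of_re_im x 0 : K k) < of_re_im y 0) = (x < y).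
Proof. by case: k => //=; rewrite ltcE eqxx. Qed.

End Scalars.

Definition borel_scalar (R : realType) (k : RorC) :=
  g_sigma_algebraType (@open (scalar_field R k)).

Section BorelScalars.
Context {R : realType} {k : RorC}.
Local Notation K := (scalar_field R k).
Local Notation BK := (borel_scalar R k).

Lemma ball_scalarE (z w : K) (r : R) :
  ball z (of_re_im r 0 : K) w = (rabs (z - w) < r) :> Prop.
Proof. by rewrite -ball_normE /= normE lt_of_re_im. Qed.

Lemma nbhs_scalarP (z : K) (A : set K) :
  nbhs z A <-> exists2 r : R, 0 < r & forall w, rabs (z - w) < r -> A w.
Proof.
split=> [/nbhs_ballP[e /= /gt0_of_re_im[r r0 ->] rA]|[r r0 rA]].
  by exists r => // w wr; apply: rA; rewrite ball_scalarE.
apply/nbhs_ballP; exists (of_re_im r 0) => /=.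
  by have := @lt_of_re_im R k 0 r; rewrite r0 => /esym; case: (k).
by move=> w; rewrite ball_scalarE; exact: rA.
Qed.

Lemma measurable_lipschitz (f : K -> R) :
  (forall z w, `|f z - f w| <= rabs (z - w)) ->
  measurable_fun setT (f : BK -> R).
Proof.
move=> fL; apply: (measurability _ (RGenOInfty.measurableE R)).
move=> _ [_ [x ->] <-]; rewrite setTI; apply: sub_sigma_algebra.
rewrite openE => z /=; rewrite in_itv/= andbT => xz; apply/nbhs_scalarP.
exists (f z - x); first by rewrite subr_gt0.
move=> w /(le_lt_trans (fL z w)) /(le_lt_trans (ler_norm _)).
by rewrite /= in_itv/= andbT ltrD2l ltrN2.
Qed.

Lemma measurable_re : measurable_fun setT (re : BK -> R).
Proof.
by apply: measurable_lipschitz => z w; rewrite -reN -reD re_le_rabs.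
Qed.

Lemma measurable_im : measurable_fun setT (im : BK -> R).
Proof.
by apply: measurable_lipschitz => z w; rewrite -imN -imD im_le_rabs.
Qed.

Definition rat_box (q : rat * rat * rat) : set K :=
  [set z | `|re z - ratr q.1.1| < ratr q.2 /\ `|im z - ratr q.1.2| < ratr q.2].

Lemma open_rat_box (U : set K) : open U ->
  U = \bigcup_(q in [set q | rat_box q `<=` U]) rat_box q.
Proof.
move=> oU; apply/seteqP; split => [z Uz|z [q]]; last exact.
have /nbhs_scalarP[r r0 rU] : nbhs z U by move: oU; rewrite openE => /(_ z Uz).
have r40 : 0 < r / 4 by rewrite divr_gt0.
have [s s0r] := rat_in_itvoo r40.
have s0 : (0 : R) < ratr s by move: s0r; rewrite in_itv => /andP[].
have sr : ratr s < r / 4 by move: s0r; rewrite in_itv => /andP[].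
have [p pz] : exists p, ratr p \in `](re z - ratr s), (re z + ratr s)[.
  by apply: rat_in_itvoo; lra.
have [q qz] : exists q, ratr q \in `](im z - ratr s), (im z + ratr s)[.
  by apply: rat_in_itvoo; lra.
move: pz qz; rewrite !in_itv/= => /andP[p1 p2] /andP[q1 q2].
exists (p, q, s) => [w|]; rewrite /rat_box /= !ltr_norml; last first.
  by split; apply/andP; split; lra.
move=> [/andP[? ?] /andP[? ?]]; apply: rU.
rewrite (le_lt_trans (rabs_le_re_im _))// reD imD reN imN.
apply: (@lt_le_trans _ _ (r / 2 + r / 2)); last by rewrite -splitr.
by rewrite ltrD// ltr_norml; apply/andP; split; lra.
Qed.

Lemma measurable_scalarP d (T : measurableType d) (f : T -> K) :
  measurable_fun setT (f : T -> BK) <->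
  measurable_fun setT (re \o f) /\ measurable_fun setT (im \o f).
Proof.
split=> [mf|[mre mim]].
  by split; [exact: measurableT_comp measurable_re mf|
             exact: measurableT_comp measurable_im mf].
apply: (@measurability _ _ T BK setT f (@open K)) => //.
move=> _ [U oU <-]; rewrite setTI (open_rat_box oU) preimage_bigcup.
rewrite bigcup_mkcond; apply: countable_bigcupT_measurable => // q.
case: ifP => // _; rewrite -[X in measurable X]setTI.
rewrite [X in measurable X](_ : _ =
    (setT `&` [set x | `|(re (f x) - ratr q.1.1)| < ratr q.2]) `&`
    (setT `&` [set x | `|(im (f x) - ratr q.1.2)| < ratr q.2])); last first.
  by rewrite !setTI.
have meas_box (g : T -> R) p : measurable_fun setT g ->
    measurable (setT `&` [set x | `|(g x - p)| < ratr q.2]).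
  move=> mg; have -> : [set x | `|g x - p| < ratr q.2] =
      (fun x => `|g x - p|) @^-1` `]-oo, ratr q.2[.
    by apply/seteqP; split => x; rewrite /= in_itv.
  suff : measurable_fun setT (fun x => `|g x - p|) by exact.
  by apply: measurableT_comp => //; exact: measurable_funB.
by apply: measurableI; exact: meas_box.
Qed.

Lemma measurable_rabs : measurable_fun setT (rabs : BK -> R).
Proof.
apply: measurable_lipschitz => z w.
have h (u v : K) : rabs u - rabs v <= rabs (u - v).
  by rewrite lerBlDr (le_trans _ (rabsD _ _))// subrK.
rewrite ler_norml h lerNl opprB (le_trans (h _ _))//.
by rewrite /rabs distrC.
Qed.

End BorelScalars.

Section L2.
Context d (T : measurableType d) (R : realType).
Variables (mu : {measure set T -> \bar R}) (k : RorC).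
Local Notation K := (scalar_field R k).

Definition sq_integrable : {pred T -> K} := fun f =>
  `[< measurable_fun setT (f : T -> borel_scalar R k) /\
      finite_norm mu 2%:E (rabs \o f) >].

Lemma sq_integrableP (f : T -> K) :
  reflect (measurable_fun setT (f : T -> borel_scalar R k) /\
           finite_norm mu 2%:E (rabs \o f)) (f \in sq_integrable).
Proof. exact: asboolP. Qed.

Let one_le2 : (1 <= 2%:E :> \bar R)%E. Proof. by rewrite lee_fin ler1n. Qed.

Lemma rabs_Lfun (f : T -> K) :
  f \in sq_integrable -> rabs \o f \in Lfun mu 2%:E.
Proof.
move=> /sq_integrableP[mf ff]; apply/andP; rewrite !inE; split => //=.
exact: measurableT_comp measurable_rabs mf.
Qed.

Lemma le_Lnorm2 (f g : T -> R) :
  measurable_fun setT f -> measurable_fun setT g ->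
  (\forall x \ae mu, 0 <= f x <= g x) ->
  ('N[mu]_2%:E[EFin \o f] <= 'N[mu]_2%:E[EFin \o g])%E.
Proof.
move=> mf mg fg; rewrite unlock /=.
have mpow (h : T -> R) : measurable_fun setT h ->
    measurable_fun setT (fun x => (`|h x| `^ 2)%:E).
  move=> mh; apply/measurable_EFinP.
  apply: (measurableT_comp (measurable_powR 2)).
  exact: measurableT_comp.
apply: gt0_ler_poweR.
all: rewrite ?invr_ge0 ?in_itv/= ?leey ?andbT//.
- by apply: integral_ge0 => x _; rewrite lee_fin powR_ge0.
- by apply: integral_ge0 => x _; rewrite lee_fin powR_ge0.
apply: (@ae_ge0_le_integral _ _ _ mu setT) => //.
- exact: mpow.
- exact: mpow.
apply: filterS fg => x /andP[f0 fgx] _.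
have g0 := le_trans f0 fgx.
by rewrite lee_fin ge0_ler_powR// ?nnegrE ?ger0_norm.
Qed.

Lemma sq_integrable_submod_closed : submod_closed sq_integrable.
Proof.
split=> [|c f g fS gS].
  apply/sq_integrableP; split; first exact: measurable_cst.
  rewrite (_ : rabs \o 0 = cst 0); last by apply/funext => x /=; exact: rabs0.
  exact: finite_norm_cst0.
have [mf ff] := sq_integrableP _ fS; have [mg fg] := sq_integrableP _ gS.
have mfg : measurable_fun setT (c *: f + g : T -> borel_scalar R k).
  move: mf mg => /measurable_scalarP[rf jf] /measurable_scalarP[rg jg].
  apply/measurable_scalarP; split.
    rewrite (_ : re \o _ =
      (fun x => re c * (re \o f) x - im c * (im \o f) x) \+ (re \o g)).
      by apply: measurable_funD => //; apply: measurable_funB;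
        exact: measurable_funM.
    by apply/funext => x /=; rewrite -reM -reD.
  rewrite (_ : im \o _ =
    (fun x => re c * (im \o f) x + im c * (re \o f) x) \+ (im \o g)).
    by apply: measurable_funD => //; apply: measurable_funD;
      exact: measurable_funM.
  by apply/funext => x /=; rewrite -imM -imD.
apply/sq_integrableP; split => //.
have : rabs c *: (rabs \o f) + (rabs \o g) \in Lfun mu 2%:E.
  by rewrite rpredD ?rpredZ// rabs_Lfun.
move=> /andP[]; rewrite !inE => m1; apply: le_lt_trans.
apply: le_Lnorm2 => //; first exact: measurableT_comp measurable_rabs mfg.
by apply: nearW => x /=; rewrite rabs_ge0 (le_trans (rabsD _ _))// rabsM.
Qed.

HB.instance Definition _ := GRing.isSubmodClosed.Build K (T -> K) sq_integrable
  sq_integrable_submod_closed.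

Record L2fun := MkL2fun { L2fun_val :> T -> K ; _ : L2fun_val \in sq_integrable }.

HB.instance Definition _ := [isSub for L2fun_val].
HB.instance Definition _ := [Choice of L2fun by <:].
HB.instance Definition _ := [SubChoice_isSubLmodule of L2fun by <:].

Definition null_fun : {pred L2fun} := fun f => `[< f = cst 0 %[ae mu] >].

Lemma null_funP (f : L2fun) : reflect (f = cst 0 %[ae mu]) (f \in null_fun).
Proof. exact: asboolP. Qed.

Lemma null_fun_submod_closed : submod_closed null_fun.
Proof.
split=> [|c f g /null_funP f0 /null_funP g0]; apply/null_funP.
  exact: nearW.
apply: filterS2 f0 g0 => x /= fx gx _.
by rewrite -[LHS]/(c * f x + g x) fx// gx// mulr0 addr0.
Qed.

HB.instance Definition _ := GRing.isSubmodClosed.Build K L2fun null_fun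
  null_fun_submod_closed.

Definition L2 := Quotient.quot null_fun.

HB.instance Definition _ := GRing.Zmodule.on L2.
HB.instance Definition _ := EqQuotient.on L2.

Definition L2_pi (f : L2fun) : L2 := \pi_L2%qT f.

Definition L2_fun (f : L2) : L2fun := repr f.

Lemma L2_pi_eq (f g : L2fun) : L2_pi f = L2_pi g <-> f = g %[ae mu].
Proof.
rewrite /L2_pi; have -> : (\pi_L2%qT f = \pi_L2%qT g) <-> (f - g \in null_fun).
  by rewrite Quotient.idealrBE; split=> /eqP.
split=> [/null_funP fg|fg]; [|apply/null_funP]; apply: filterS fg => x /(_ I).
  by move=> /eqP; rewrite subr_eq0 => /eqP.
by move=> fg _; apply/eqP; rewrite subr_eq0; apply/eqP.
Qed.

Lemma L2_funK (f : L2) : L2_pi (L2_fun f) = f.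
Proof. exact: reprK. Qed.

Lemma L2_piK (f : L2fun) : L2_fun (L2_pi f) = f %[ae mu].
Proof. by apply/L2_pi_eq; rewrite L2_funK. Qed.

Lemma L2_eqP (f g : L2) : f = g <-> L2_fun f = L2_fun g %[ae mu].
Proof. by rewrite -L2_pi_eq !L2_funK. Qed.

Lemma L2_piD (f g : L2fun) : L2_pi (f + g) = L2_pi f + L2_pi g.
Proof. by rewrite /L2_pi !piE. Qed.

Definition L2_scale (c : K) (f : L2) : L2 := L2_pi (c *: L2_fun f).

Lemma L2_scale_pi (c : K) (f : L2fun) : L2_scale c (L2_pi f) = L2_pi (c *: f).
Proof.
by apply/L2_pi_eq; apply: filterS (L2_piK f) => x fx _; congr (c * _); exact: fx.
Qed.

Lemma L2_scalerA (a b : K) (f : L2) :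
  L2_scale a (L2_scale b f) = L2_scale (a * b) f.
Proof. by rewrite -[f]L2_funK !L2_scale_pi scalerA. Qed.

Lemma L2_scale1r : left_id 1 L2_scale.
Proof. by move=> f; rewrite -[f]L2_funK !L2_scale_pi scale1r. Qed.

Lemma L2_scalerDr : right_distributive L2_scale +%R.
Proof.
move=> a f g; rewrite -[f]L2_funK -[g]L2_funK -L2_piD !L2_scale_pi.
by rewrite scalerDr L2_piD.
Qed.

Lemma L2_scalerDl (f : L2) : {morph L2_scale^~ f : a b / a + b}.
Proof.
by move=> a b; rewrite -[f]L2_funK !L2_scale_pi -L2_piD scalerDl.
Qed.

HB.instance Definition _ := GRing.Zmodule_isLmodule.Build K L2
  L2_scalerA L2_scale1r L2_scalerDr L2_scalerDl.

Lemma L2_funD (f g : L2) :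
  L2_fun (f + g) = (fun x => L2_fun f x + L2_fun g x) %[ae mu].
Proof.
by have := L2_piK (L2_fun f + L2_fun g); rewrite L2_piD !L2_funK.
Qed.

Lemma L2_funZ c (f : L2) :
  L2_fun (c *: f) = (fun x => c * L2_fun f x) %[ae mu].
Proof. exact: (L2_piK (c *: L2_fun f)). Qed.

Lemma L2_fun0 : L2_fun 0 = cst 0 %[ae mu].
Proof.
have -> : (0 : L2) = L2_pi 0 by rewrite /L2_pi piE.
exact: (L2_piK 0).
Qed.

Definition L2_norm (f : L2) : R := fine 'N[mu]_2%:E[EFin \o (rabs \o L2_fun f)].

Lemma L2_funP (f : L2) : (L2_fun f : T -> K) \in sq_integrable.
Proof. exact: valP. Qed.

Lemma L2_normE (f : L2) :
  (L2_norm f)%:E = ('N[mu]_2%:E[EFin \o (rabs \o L2_fun f)])%E.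
Proof.
rewrite /L2_norm fineK// ge0_fin_numE ?Lnorm_ge0//.
by have [] := sq_integrableP _ (L2_funP f).
Qed.

Let mrabs (f : L2) : measurable_fun setT (rabs \o L2_fun f).
Proof.
have [mf _] := sq_integrableP _ (L2_funP f).
exact: measurableT_comp measurable_rabs mf.
Qed.

Lemma L2_normD (f g : L2) : L2_norm (f + g) <= L2_norm f + L2_norm g.
Proof.
rewrite -lee_fin EFinD !L2_normE.
apply: le_trans (eminkowski _ (mrabs f) (mrabs g) one_le2).
apply: le_Lnorm2 => //; first exact: measurable_funD.
by apply: filterS (L2_funD f g) => x /(_ I) /= ->; rewrite rabs_ge0 rabsD.
Qed.

Lemma L2_normZ c (f : L2) : L2_norm (c *: f) = rabs c * L2_norm f.
Proof.
apply: EFin_inj; rewrite EFinM !L2_normE.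
have := LnormZ (Lfun_Sub one_le2 (rabs_Lfun (L2_funP f))) (rabs c).
rewrite ger0_norm ?rabs_ge0//= => <-.
have mc : measurable_fun setT (rabs c \*: (rabs \o L2_fun f)).
  by apply: measurable_funM => //; exact: mrabs.
apply/eqP; rewrite eq_le; apply/andP; split; apply: le_Lnorm2 => //.
  by apply: filterS (L2_funZ c f) => x /(_ I) /= ->; rewrite rabsM mulr_ge0 ?rabs_ge0 /=.
by apply: filterS (L2_funZ c f) => x /(_ I) /= ->; rewrite rabsM mulr_ge0 ?rabs_ge0 /=.
Qed.

Lemma L2_norm_eq0 (f : L2) : L2_norm f = 0 -> f = 0.
Proof.
move=> f0; have := L2_normE f; rewrite f0 => /esym/Lnorm_eq0_eq0.
have mf : measurable_fun setT (EFin \o (rabs \o L2_fun f)).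
  exact/measurable_EFinP.
move=> /(_ mf); rewrite lte_fin ltr0n => /(_ isT) fae; apply/L2_eqP.
apply: filterS2 fae L2_fun0 => x /(_ I) [/rabs0_eq0 fx] /(_ I) -> _.
exact: fx.
Qed.

Let l2norm (f : L2) : K := of_re_im (L2_norm f) 0.

Let l2normD (f g : L2) : l2norm (f + g) <= l2norm f + l2norm g.
Proof. by rewrite -of_re_imD ler_of_re_im L2_normD. Qed.

Let l2normZ c (f : L2) : l2norm (c *: f) = `|c| * l2norm f.
Proof. by rewrite /l2norm L2_normZ of_re_imM -normE. Qed.

Let l2norm_eq0 (f : L2) : l2norm f = 0 -> f = 0.
Proof.
move=> /(congr1 re); rewrite re_of_re_im re0; exact: L2_norm_eq0.
Qed.

HB.instance Definition _ := @Lmodule_isNormed.Build K L2 l2norm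
  l2normD l2normZ l2norm_eq0.

Lemma normL2E (f : L2) :
  re `|f| = fine 'N[mu]_2%:E[EFin \o (rabs \o L2_fun f)].
Proof. exact: re_of_re_im. Qed.

Definition L2_inner (f g : L2) : K :=
  of_re_im (\int[mu]_x re (L2_fun f x * conj (L2_fun g x)))
           (\int[mu]_x im (L2_fun f x * conj (L2_fun g x))).

End L2.
Arguments L2_inner {d T R} mu k f g.

(* A (possibly unbounded) operator is identified with its graph: an operator
   [A] is a linear subspace of [V * V] such that [A (x, y)] and [A (x, y')]
   imply [y = y'], and [A (x, y)] reads "x is in the domain and A x = y". *)
Section Operators.
Context {R : realType} {k : RorC} {V : normedModType (scalar_field R k)}.
Local Notation K := (scalar_field R k).
Implicit Types A : set (V * V).

Definition is_operator A :=
  [/\ A (0, 0),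
      forall c x y x' y', A (x, y) -> A (x', y') -> A (c *: x + x', c *: y + y')
    & forall x y y', A (x, y) -> A (x, y') -> y = y'].

(* The norm of [V], with values in [R]. *)
Definition rnorm (x : V) : R := re `|x|.

Definition op_dom A : set V := [set x | exists y, A (x, y)].

Definition op_inj A := forall x x' y, A (x, y) -> A (x', y) -> x = x'.

Definition op_inv A : set (V * V) := [set p | A (p.2, p.1)].

(* lambda I - A *)
Definition op_shift (lambda : K) A : set (V * V) :=
  [set p | exists2 y, A (p.1, y) & p.2 = lambda *: p.1 - y].

Definition op_bounded A := op_dom A = setT /\
  exists C : R, forall x y, A (x, y) -> rnorm y <= C * rnorm x.

(* Only meaningful for bounded operators. *)
Definition op_norm A : R :=
  sup [set r | exists x y, [/\ A (x, y), rnorm x <= 1 & r = rnorm y]].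

Definition resolvent_set A : set K :=
  [set lambda | op_inj (op_shift lambda A) /\
                op_bounded (op_inv (op_shift lambda A))].

Definition resolvent (lambda : K) A := op_inv (op_shift lambda A).

Definition spectrum A : set K := ~` resolvent_set A.

Definition approx_point_spectrum A : set K :=
  [set lambda | exists x y : nat -> V,
    [/\ forall n, op_shift lambda A (x n, y n),
        forall n, rnorm (x n) = 1
      & y @ \oo --> (0 : V)]].

(* [inner] is meant to be the scalar product of a Hilbert space [V]. *)
Variable inner : V -> V -> K.

Definition op_adjoint A : set (V * V) :=
  [set p | forall x y, A (x, y) -> inner y p.1 = inner x p.2].

Definition op_symmetric A := dense (op_dom A) /\
  forall x y x' y', A (x, y) -> A (x', y') -> inner y x' = inner x y'.

Definition op_selfadjoint A := dense (op_dom A) /\ A = op_adjoint A.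

End Operators.

Section Multiplication.
Context d (T : measurableType d) (R : realType) (k : RorC).
Variable mu : {measure set T -> \bar R}.
Local Notation K := (scalar_field R k).
Local Notation L2 := (L2 mu k).

(* [f] is in the domain iff [a * f] is almost everywhere equal to a
   square-integrable function [g], and then [g] is the image of [f].  Only the
   class of [a] modulo equality almost everywhere matters, so that values
   of [a] on a null set are irrelevant. *)
Definition mulop (a : T -> K) : set (L2 * L2) :=
  [set p | L2_fun p.2 = (fun x => a x * L2_fun p.1 x) %[ae mu]].

Lemma mulop_is_operator (a : T -> K) : is_operator (mulop a).
Proof.
split=> [|c f g f' g'|f g g']; rewrite /mulop /=.
- by apply: filterS (L2_fun0 mu k) => x /(_ I) /= ->; rewrite mulr0.
- move=> fg fg'.
  have e1 := L2_funD (c *: f) f'; have e2 := L2_funZ c f.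
  have e3 := L2_funD (c *: g) g'; have e4 := L2_funZ c g.
  near=> x => _.
  rewrite (near e1 x)// (near e2 x)// (near e3 x)// (near e4 x)//.
  by rewrite (near fg x)// (near fg' x)// mulrDr mulrCA.
- move=> fg fg'; apply/L2_eqP; apply: filterS2 fg fg' => x /(_ I) -> /(_ I) ->.
  by [].
Unshelve. all: by end_near. Qed.

Lemma eq_mulop (a b : T -> K) : a = b %[ae mu] -> mulop a = mulop b.
Proof.
move=> ab; apply/seteqP; split => -[f g] /= fg;
  by apply: filterS2 ab fg => x /(_ I) abx /(_ I) -> _; rewrite abx.
Qed.

Definition Linfty (a : T -> K) :=
  measurable_fun setT (a : T -> borel_scalar R k) /\
  finite_norm mu +oo (rabs \o a).

Definition essran (a : T -> K) : set K :=
  [set lambda | forall eps : R, 0 < eps ->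
    (0 < mu [set x | (rabs (a x - lambda) <= eps)%R])%E].

End Multiplication.
Arguments mulop {d T R k} mu a.

Definition semifinite d (T : measurableType d) (R : realType)
    (mu : {measure set T -> \bar R}) :=
  forall A, measurable A -> mu A = +oo%E ->
  exists B, [/\ measurable B, B `<=` A & (0 < mu B < +oo)%E].

(* Main.v *)
Require Import Defs.
From mathcomp Require Import all_boot all_order all_algebra.
From mathcomp Require Import all_classical all_reals all_analysis.
From mathcomp Require Import measurable_realfun ess_sup_inf ring lra.
From mathcomp.real_closed Require Import complex.
Set Implicit Arguments.
Unset Strict Implicit.
Unset Printing Implicit Defensive.
Import Order.TTheory GRing.Theory Num.Theory.
Import numFieldNormedType.Exports.
Local Open Scope classical_set_scope.
Local Open Scope ring_scope.

(** The whole theorem rests on one construction. In a semi-finite space every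
    measurable set [E] of positive measure carries a unit vector of L2 that
    vanishes off [E] ([unit_supported]). So a set is null as soon as no unit
    vector supported on it can exist ([ae_notin_of_unit]), and each necessity
    statement follows by choosing [E] to be the set where the pointwise
    condition fails: the zero set of [a] for injectivity, the set where
    [rabs \o a] exceeds a constant for boundedness and the norm, the set where
    [a] is close to [l] for approximate eigenvectors, the set where two symbols
    differ for uniqueness, and the set where [a] is not real for symmetry. When
    the vector has to be in the domain of an unbounded operator, [E] is first
    intersected with a sublevel set of [rabs \o a] ([mulop_supported],
    [ae_bounded_pieces]).

    The sufficiency statements are pointwise estimates. A symbol bounded almost
    everywhere by [c] gives an everywhere defined operator of norm at most [c]
    ([mulop_le_of_ae_le]), and the inverse of multiplication by [a] is
    multiplication by the inverse of [a] ([op_inv_mulop]). Since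
    [l I - M_a] is multiplication by [l - a] ([op_shift_mulop]), the resolvent
    formula is an instance of the formula for the inverse, and the spectrum is
    squeezed: it lies in the essential range, which lies in the approximate
    point spectrum, which lies in the spectrum of any operator.

    For self-adjointness the delicate inclusion is that of the adjoint in the
    operator. Completeness of L2 is avoided: two vectors [g] and [h] whose inner
    products with [g - h] agree are equal ([eq_of_inner_sub]), and after a
    cutoff the test vector [g - h] is itself in the domain. *)

(** * Arithmetic and measurability of scalar-valued functions *)

Section scalar_measurability.
Context {R : realType} {k : RorC}.
Local Notation K := (scalar_field R k).
Local Notation BK := (borel_scalar R k).

Lemma reV (z : K) : re z^-1 = re z / (re z ^+ 2 + im z ^+ 2).
Proof.
case: k z => /= [z|[a b]] //=; rewrite expr0n /= addr0.
have [->|z0] := eqVneq z 0; rewrite ?invr0 ?mul0r//.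
by rewrite expr2 invfM mulrA divff ?mul1r.
Qed.

Lemma imV (z : K) : im z^-1 = - im z / (re z ^+ 2 + im z ^+ 2).
Proof. by case: k z => /= [z|[a b]]; rewrite ?mulNr// mul0r oppr0. Qed.

Lemma re_conj (z : K) : re (conj z) = re z.
Proof. by case: k z => //= -[]. Qed.

Lemma im_conj (z : K) : im (conj z) = - im z.
Proof. by case: k z => [z|[a b]] //=; rewrite oppr0. Qed.

Lemma re_im_inj (z w : K) : re z = re w -> im z = im w -> z = w.
Proof. by case: k z w => //= -[a b] [c e] /= -> ->. Qed.

Lemma rabs_sq (z : K) : rabs z ^+ 2 = re z ^+ 2 + im z ^+ 2.
Proof. by rewrite rabsE sqr_sqrtr// addr_ge0// sqr_ge0. Qed.

Lemma rabsV (z : K) : rabs z^-1 = (rabs z)^-1.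
Proof.
have [->|z0] := eqVneq z 0; first by rewrite !invr0 rabs0 invr0.
have rz0 : rabs z != 0 by apply: contra z0 => /eqP/rabs0_eq0 ->.
apply: (mulfI rz0); rewrite -rabsM !divff//.
by rewrite /rabs normr1; case: (k).
Qed.

Lemma rabsN (z : K) : rabs (- z) = rabs z.
Proof. by rewrite /rabs normrN. Qed.

Lemma rabs_conj (z : K) : rabs (conj z) = rabs z.
Proof. by rewrite !rabsE re_conj im_conj sqrrN. Qed.

Lemma rabs_of_re_im (c : R) : 0 <= c -> rabs (of_re_im c 0 : K) = c.
Proof.
move=> c0; rewrite rabsE re_of_re_im.
by case: (k) => /=; rewrite expr0n addr0 sqrtr_sqr ger0_norm.
Qed.

Lemma rabs_le0 (z : K) : rabs z <= 0 <-> z = 0.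
Proof.
split=> [z0|->]; last by rewrite rabs0.
by apply: rabs0_eq0; apply/eqP; rewrite eq_le z0 rabs_ge0.
Qed.

Lemma rabs_indic_le1 (T : Type) (E : set T) x : rabs (\1_E x : K) <= 1.
Proof.
rewrite indicE /rabs.
by case: (_ \in _); rewrite ?normr0 ?normr1; case: (k) => /=.
Qed.

Context d {T : measurableType d}.
Implicit Types f g : T -> K.

Lemma measurable_scalarM f g :
  measurable_fun setT (f : T -> BK) -> measurable_fun setT (g : T -> BK) ->
  measurable_fun setT ((fun x => f x * g x) : T -> BK).
Proof.
move=> /measurable_scalarP[rf jf] /measurable_scalarP[rg jg].
apply/measurable_scalarP; split.
  rewrite (_ : re \o _ = (fun x =>
    (re \o f) x * (re \o g) x - (im \o f) x * (im \o g) x)); last first.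
    by apply/funext => x /=; rewrite reM.
  by apply: measurable_funB; exact: measurable_funM.
rewrite (_ : im \o _ = (fun x =>
  (re \o f) x * (im \o g) x + (im \o f) x * (re \o g) x)); last first.
  by apply/funext => x /=; rewrite imM.
by apply: measurable_funD; exact: measurable_funM.
Qed.

Lemma measurable_scalarB f g :
  measurable_fun setT (f : T -> BK) -> measurable_fun setT (g : T -> BK) ->
  measurable_fun setT ((fun x => f x - g x) : T -> BK).
Proof.
move=> /measurable_scalarP[rf jf] /measurable_scalarP[rg jg].
apply/measurable_scalarP; split.
  rewrite (_ : re \o _ = (fun x => (re \o f) x - (re \o g) x)).
    exact: measurable_funB.
  by apply/funext => x /=; rewrite reD reN.
rewrite (_ : im \o _ = (fun x => (im \o f) x - (im \o g) x)).
  exact: measurable_funB.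
by apply/funext => x /=; rewrite imD imN.
Qed.

Lemma measurable_scalar_conj f : measurable_fun setT (f : T -> BK) ->
  measurable_fun setT ((fun x => conj (f x)) : T -> BK).
Proof.
move=> /measurable_scalarP[rf jf]; apply/measurable_scalarP; split.
  by rewrite (_ : re \o _ = re \o f)//; apply/funext => x /=; rewrite re_conj.
rewrite (_ : im \o _ = (fun x => - (im \o f) x)).
  exact: measurableT_comp.
by apply/funext => x /=; rewrite im_conj.
Qed.

Lemma measurable_scalarV f : measurable_fun setT (f : T -> BK) ->
  measurable_fun setT ((fun x => (f x)^-1) : T -> BK).
Proof.
move=> /measurable_scalarP[rf jf].
have mD : measurable_fun setT
    (fun x => ((re \o f) x ^+ 2 + (im \o f) x ^+ 2)^-1).
  (* A nonnegative real has [y `^ (-1) = y^-1], even for [y = 0]. *)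
  rewrite (_ : (fun _ => _) = (fun y : R => y `^ (-1)) \o
      (fun x => (re \o f) x ^+ 2 + (im \o f) x ^+ 2)); last first.
    by apply/funext => x /=; rewrite powR_inv1// addr_ge0// sqr_ge0.
  apply: (measurableT_comp (measurable_powR (-1))).
  by apply: measurable_funD; exact: measurable_funX.
apply/measurable_scalarP; split.
  rewrite (_ : re \o _ = (fun x =>
    (re \o f) x * ((re \o f) x ^+ 2 + (im \o f) x ^+ 2)^-1)).
    exact: measurable_funM.
  by apply/funext => x /=; rewrite reV.
rewrite (_ : im \o _ = (fun x =>
  - (im \o f) x * ((re \o f) x ^+ 2 + (im \o f) x ^+ 2)^-1)).
  by apply: measurable_funM => //; exact: measurableT_comp.
by apply/funext => x /=; rewrite imV.
Qed.

Lemma measurable_scalar_indic (E : set T) : measurable E ->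
  measurable_fun setT ((\1_E : T -> K) : T -> BK).
Proof.
move=> mE; apply/measurable_scalarP; split.
  rewrite (_ : re \o _ = (\1_E : T -> R)); first exact: measurable_indic.
  by apply/funext => x /=; rewrite !indicE; case: (x \in E); case: k.
rewrite (_ : im \o _ = cst 0); first exact: measurable_cst.
by apply/funext => x /=; rewrite indicE; case: (x \in E); case: k.
Qed.

Lemma measurable_rabs_comp f : measurable_fun setT (f : T -> BK) ->
  measurable_fun setT (rabs \o f).
Proof. exact: measurableT_comp measurable_rabs. Qed.

Lemma measurable_rabs_le f (c : R) : measurable_fun setT (f : T -> BK) ->
  measurable [set x | rabs (f x) <= c].
Proof.
move=> /measurable_rabs_comp mf.
rewrite (_ : [set _ | _] = setT `&` (rabs \o f) @^-1` `]-oo, c]).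
  by apply: mf => //; exact: measurable_itv.
by rewrite setTI; apply/seteqP; split => x /=; rewrite in_itv.
Qed.

Lemma measurable_eq0 f : measurable_fun setT (f : T -> BK) ->
  measurable [set x | f x = 0].
Proof.
move=> mf; rewrite (_ : [set _ | _] = [set x | rabs (f x) <= 0]).
  exact: measurable_rabs_le.
by apply/seteqP; split => x /= /rabs_le0.
Qed.

End scalar_measurability.

(** * Existence and norm estimates for square-integrable functions *)

Section L2_facts.
Context {d} {T : measurableType d} {R : realType} {k : RorC}.
Variable mu : {measure set T -> \bar R}.
Local Notation K := (scalar_field R k).
Local Notation BK := (borel_scalar R k).
Local Notation L2 := (L2 mu k).
Implicit Types (f g h : L2).

Lemma L2_fun_measurable f : measurable_fun setT (L2_fun f : T -> BK).
Proof. by have /sq_integrableP[] := L2_funP f. Qed.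

Lemma rnormE f : rnorm f = L2_norm f.
Proof. exact: re_of_re_im. Qed.

Lemma rnorm_ge0 f : 0 <= rnorm f.
Proof. by rewrite rnormE fine_ge0// Lnorm_ge0. Qed.

Lemma rnorm_eq0 f : rnorm f = 0 -> f = 0.
Proof. by rewrite rnormE => /L2_norm_eq0. Qed.

Lemma rnorm0 : rnorm (0 : L2) = 0.
Proof. by rewrite /rnorm normr0 re0. Qed.

Lemma rnormZ c f : rnorm (c *: f) = rabs c * rnorm f.
Proof. by rewrite !rnormE L2_normZ. Qed.

Lemma Lnorm2_sq (u : T -> R) :
  ('N[mu]_2%:E[EFin \o u] `^ 2 = \int[mu]_x (u x ^+ 2)%:E)%E.
Proof.
rewrite poweR_Lnorm//; apply: eq_integral => x _ /=.
by rewrite powR_mulrn// -normrX ger0_norm// sqr_ge0.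
Qed.

Lemma rnorm_sq f :
  ((rnorm f ^+ 2)%:E = \int[mu]_x (rabs (L2_fun f x) ^+ 2)%:E)%E.
Proof.
rewrite -(Lnorm2_sq (rabs \o L2_fun f)) -L2_normE -rnormE /=.
by rewrite powR_mulrn ?rnorm_ge0.
Qed.

Lemma L2_exists (u : T -> K) : measurable_fun setT (u : T -> BK) ->
  (\int[mu]_x (rabs (u x) ^+ 2)%:E < +oo)%E ->
  exists f, L2_fun f = u %[ae mu].
Proof.
move=> meas_u u2.
have uL : u \in sq_integrable mu (k:=k).
  apply/sq_integrableP; split=> //; rewrite /finite_norm.
  have : ('N[mu]_2%:E[EFin \o (rabs \o u)] `^ 2 < +oo)%E by rewrite Lnorm2_sq.
  exact: lty_poweRy.
by exists (L2_pi (MkL2fun uL)); exact: L2_piK.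
Qed.

Lemma le_rnorm f g :
  (\forall x \ae mu, rabs (L2_fun f x) <= rabs (L2_fun g x)) ->
  rnorm f <= rnorm g.
Proof.
move=> fg; rewrite !rnormE -lee_fin !L2_normE; apply: le_Lnorm2.
- exact/measurable_rabs_comp/L2_fun_measurable.
- exact/measurable_rabs_comp/L2_fun_measurable.
by apply: filterS fg => x /= ->; rewrite rabs_ge0.
Qed.

Lemma le_rnormM f g (c : R) : 0 <= c ->
  (\forall x \ae mu, rabs (L2_fun f x) <= c * rabs (L2_fun g x)) ->
  rnorm f <= c * rnorm g.
Proof.
move=> c0 fg; rewrite -{1}(@rabs_of_re_im _ k _ c0) -rnormZ; apply: le_rnorm.
apply: filterS2 fg (L2_funZ (of_re_im c 0) g) => x fgx /(_ I) ->.
by rewrite rabsM rabs_of_re_im.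
Qed.

Lemma ge_rnormM f g (c : R) : 0 <= c ->
  (\forall x \ae mu, c * rabs (L2_fun g x) <= rabs (L2_fun f x)) ->
  c * rnorm g <= rnorm f.
Proof.
move=> c0 fg; rewrite -{1}(@rabs_of_re_im _ k _ c0) -rnormZ; apply: le_rnorm.
apply: filterS2 fg (L2_funZ (of_re_im c 0) g) => x fgx /(_ I) ->.
by rewrite rabsM rabs_of_re_im.
Qed.

(** Images under multiplication operators are produced in this way:
    square-integrability is inherited from a dominating class. *)
Lemma L2_dominated (u : T -> K) f (c : R) : measurable_fun setT (u : T -> BK) ->
  (\forall x \ae mu, rabs (u x) <= c * rabs (L2_fun f x)) ->
  exists g, L2_fun g = u %[ae mu].
Proof.
move=> meas_u uf; apply: L2_exists => //.
have mf := measurable_rabs_comp (L2_fun_measurable f).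
apply: (@le_lt_trans _ _ (\int[mu]_x (c ^+ 2 * rabs (L2_fun f x) ^+ 2)%:E)%E).
  apply: ae_ge0_le_integral => //.
  - by move=> x _; rewrite lee_fin sqr_ge0.
  - apply/measurable_EFinP; apply: measurable_funX.
    exact: measurable_rabs_comp.
  - by move=> x _; rewrite lee_fin mulr_ge0// sqr_ge0.
  - apply/measurable_EFinP; apply: measurable_funM => //.
    exact: measurable_funX.
  apply: filterS uf => x ufx _; rewrite lee_fin -exprMn ler_sqr// nnegrE.
    exact: rabs_ge0.
  exact: le_trans (rabs_ge0 _) ufx.
under eq_integral do rewrite EFinM.
rewrite ge0_integralZl//; last 3 first.
- by apply/measurable_EFinP; exact: measurable_funX.
- by move=> x _; rewrite lee_fin sqr_ge0.
- by rewrite lee_fin sqr_ge0.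
by rewrite -rnorm_sq -EFinM ltry.
Qed.

Lemma ae_absurd (E : set T) : measurable E -> (0 < mu E)%E ->
  ~ (\forall x \ae mu, ~ E x).
Proof.
move=> mE E0 [N [mN N0 EN]]; move: E0.
rewrite (@subset_measure0 _ _ _ mu E N) ?ltxx// => x Ex.
by apply: EN => /=; exact.
Qed.

(** This is where semi-finiteness enters: a set of positive measure contains a
    set [B] of finite positive measure, and the indicator of [B] can then be
    normalized in L2. *)
Lemma unit_supported (E : set T) : semifinite mu -> measurable E ->
  (0 < mu E)%E ->
  exists2 f : L2, rnorm f = 1 & \forall x \ae mu, ~ E x -> L2_fun f x = 0.
Proof.
move=> sf mE E0.
have [B [mB BE /andP[B0 By]]] :
    exists B, [/\ measurable B, B `<=` E & (0 < mu B < +oo)%E].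
  have [/eqP/(sf _ mE)//|Ey] := boolP (mu E == +oo%E).
  by exists E; split => //; rewrite E0 ltey.
have [|f fB] := @L2_exists (\1_B : T -> K) (measurable_scalar_indic mB).
  rewrite (eq_integral (fun x => (\1_B x)%:E)) ?integral_indic ?setIT//.
  move=> x _; rewrite !indicE; case: (x \in B); rewrite /= /rabs.
    by rewrite normr1; case: (k); rewrite /= expr1n.
  by rewrite normr0; case: (k); rewrite /= expr0n.
have f0 : rnorm f != 0.
  apply/eqP => /rnorm_eq0 f0; apply: (ae_absurd mB B0).
  move: fB; rewrite f0 => fB.
  apply: filterS2 fB (L2_fun0 mu k) => x /(_ I) -> /(_ I) /eqP + Bx.
  by rewrite indicE mem_set//= oner_eq0.
exists (of_re_im (rnorm f)^-1 0 *: f).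
  by rewrite rnormZ rabs_of_re_im ?invr_ge0 ?rnorm_ge0// mulVf.
apply: filterS2 fB (L2_funZ (of_re_im (rnorm f)^-1 0) f) => x /(_ I) fB.
move=> /(_ I) -> Ex; rewrite fB indicE memNset ?mulr0//.
by move=> /BE.
Qed.

Lemma rnorm1_neq0 f : rnorm f = 1 -> ~ (\forall x \ae mu, L2_fun f x = 0).
Proof.
move=> f1 fae; suff : f = 0 by move=> f0; move: f1; rewrite f0 rnorm0 => /eqP;
  rewrite eq_sym oner_eq0.
apply/L2_eqP; apply: filterS2 fae (L2_fun0 mu k) => x -> /(_ I) -> _.
by [].
Qed.

End L2_facts.

(** * Injectivity, norm and uniqueness of the symbol *)

Section mulop_lemmas.
Context {d} {T : measurableType d} {R : realType} {k : RorC}.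
Variable mu : {measure set T -> \bar R}.
Local Notation K := (scalar_field R k).
Local Notation BK := (borel_scalar R k).
Local Notation L2 := (L2 mu k).
Implicit Types (f g h : L2) (a b : T -> K) (E : set T).

Lemma measure0_aeP E : measurable E -> mu E = 0%E <-> \forall x \ae mu, ~ E x.
Proof.
move=> mE; split=> [E0|[N [mN N0 EN]]].
  by exists E; split => // x /= /contrapT.
by apply: (subset_measure0 mE mN _ N0) => x Ex; apply: EN => /=; exact.
Qed.

(** The contrapositive of [unit_supported], in the form in which it is used:
    to see that [E] is a null set, refute any unit vector vanishing off [E]. *)
Lemma ae_notin_of_unit E : semifinite mu -> measurable E ->
  (forall f, rnorm f = 1 -> (\forall x \ae mu, ~ E x -> L2_fun f x = 0) ->
    False) ->
  \forall x \ae mu, ~ E x.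
Proof.
move=> sf mE noE; apply/measure0_aeP => //; apply: contrapT => E0.
have [|f f1 fE] := @unit_supported _ _ _ k _ _ sf mE; last exact: noE f1 fE.
by rewrite lt0e measure_ge0 andbT; apply/eqP.
Qed.

(** The sublevel sets of [rabs \o a] exhaust the space, so an almost
    everywhere property may be checked where [a] is bounded. *)
Lemma ae_bounded_pieces a (P : T -> Prop) :
  (forall n : nat, \forall x \ae mu, rabs (a x) <= n%:R -> P x) ->
  \forall x \ae mu, P x.
Proof.
move=> /ae_foralln; apply: filterS => x; apply.
exact: ltW (archi_boundP (rabs_ge0 (a x))).
Qed.

(** A vector supported where [a] is bounded lies in the domain of the
    multiplication operator, whatever the behaviour of [a] elsewhere. *)
Lemma mulop_supported a f E (c : R) : measurable_fun setT (a : T -> BK) ->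
  0 <= c -> (forall x, E x -> rabs (a x) <= c) ->
  (\forall x \ae mu, ~ E x -> L2_fun f x = 0) ->
  exists2 g, mulop mu a (f, g) & rnorm g <= c * rnorm f.
Proof.
move=> ma c0 ac fE.
have af : \forall x \ae mu, rabs (a x * L2_fun f x) <= c * rabs (L2_fun f x).
  apply: filterS fE => x fE; rewrite rabsM.
  have [Ex|/fE ->] := pselect (E x); last by rewrite rabs0 !mulr0.
  by rewrite ler_wpM2r ?rabs_ge0// ac.
have [g ga] := L2_dominated (measurable_scalarM ma (L2_fun_measurable f)) af.
exists g => //; apply: le_rnormM => //.
by apply: filterS2 af ga => x afx /(_ I) ->.
Qed.

Lemma mulop_inj_of_neq0 a :
  (\forall x \ae mu, a x <> 0) -> op_inj (mulop mu a).
Proof.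
move=> a0 f f' g; rewrite /mulop /= => fg f'g; apply/L2_eqP; near=> x => _.
have ax : a x <> 0 by near: x.
apply: (mulfI (introN eqP ax)).
by rewrite -(near fg x)// -(near f'g x).
Unshelve. all: by end_near. Qed.

(** A unit vector supported on the zero set of [a] would be in the kernel. *)
Lemma mulop_injP a : semifinite mu -> measurable_fun setT (a : T -> BK) ->
  op_inj (mulop mu a) <-> \forall x \ae mu, a x <> 0.
Proof.
move=> sf ma; split=> [inja|]; last exact: mulop_inj_of_neq0.
apply: (ae_notin_of_unit sf (measurable_eq0 ma)) => f f1 fE.
suff f0 : f = 0.
  by move: f1; rewrite f0 rnorm0 => /eqP; rewrite eq_sym oner_eq0.
apply: (inja _ _ 0); apply: filterS2 fE (L2_fun0 mu k) => x /= fx.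
  by move=> /(_ I) -> _; have [->|/fx ->] := pselect (a x = 0);
    rewrite ?mul0r ?mulr0.
by move=> /(_ I) -> _; rewrite mulr0.
Qed.

Lemma op_inv_mulop a : (\forall x \ae mu, a x <> 0) ->
  op_inv (mulop mu a) = mulop mu (fun x => (a x)^-1).
Proof.
move=> a0; apply/seteqP; split => -[f g] /= fg;
  rewrite /op_inv /mulop /= in fg *;
  apply: filterS2 a0 fg => x /eqP ax /(_ I) -> _.
  by rewrite mulKf.
by rewrite mulVKf.
Qed.

Lemma mulop_le_of_ae_le a (c : R) : measurable_fun setT (a : T -> BK) -> 0 <= c ->
  (\forall x \ae mu, rabs (a x) <= c) ->
  op_dom (mulop mu a) = setT /\
  forall f g, mulop mu a (f, g) -> rnorm g <= c * rnorm f.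
Proof.
move=> ma c0 ac; split=> [|f g fg].
  apply/seteqP; split => // f _.
  have [|g ga] := @L2_dominated _ _ _ _ mu _ f c
    (measurable_scalarM ma (L2_fun_measurable f)); last by exists g.
  by apply: filterS ac => x ac; rewrite rabsM ler_wpM2r ?rabs_ge0.
apply: le_rnormM => //; apply: filterS2 ac fg => x ac /(_ I) /= ->.
by rewrite rabsM ler_wpM2r ?rabs_ge0.
Qed.

(** Conversely, an operator bound controls the symbol: for [c] above the bound
    [C], a unit vector supported where [rabs (a x)] exceeds [c] would be mapped
    to a vector of norm at least [c]. The room between [C] and [c] replaces a
    strict integral inequality. *)
Lemma ae_le_of_mulop_le a (C c : R) : semifinite mu ->
  measurable_fun setT (a : T -> BK) -> 0 <= C -> C < c ->
  op_dom (mulop mu a) = setT ->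
  (forall f g, mulop mu a (f, g) -> rnorm f <= 1 -> rnorm g <= C) ->
  \forall x \ae mu, rabs (a x) <= c.
Proof.
move=> sf ma C0 Cc doma aC.
suff : \forall x \ae mu, ~ (~` [set x | rabs (a x) <= c]) x.
  by apply: filterS => x /contrapT.
apply: (ae_notin_of_unit sf).
  by apply: (@measurableC _ _ [set x | rabs (a x) <= c]);
    exact: measurable_rabs_le.
move=> f f1 fE; have [g fg] : op_dom (mulop mu a) f by rewrite doma.
have gC : rnorm g <= C by apply: aC fg _; rewrite f1.
move: (le_lt_trans gC Cc).
apply/negP; rewrite -leNgt -[c]mulr1 -f1; apply: ge_rnormM.
  exact: le_trans C0 (ltW Cc).
apply: filterS2 fE fg => x fE /(_ I) /= ->; rewrite rabsM.
have [ac|/fE ->] := pselect (~ (rabs (a x) <= c)).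
  by rewrite ler_wpM2r ?rabs_ge0// ltW// ltNge; apply/negP.
by rewrite rabs0 !mulr0.
Qed.

(** On a space of measure [0] the norm is [0] by definition, and every property
    holds almost everywhere. *)
Lemma Linfty_ge a : \forall x \ae mu,
  ((rabs (a x))%:E <= 'N[mu]_+oo[EFin \o (rabs \o a)])%E.
Proof.
rewrite unlock; case: ifPn => [_|mu0].
  apply: filterS (ess_sup_ge mu (abse \o (EFin \o (rabs \o a)))) => x /=.
  by rewrite ger0_norm ?rabs_ge0.
exists setT; split => //; apply/eqP.
by rewrite eq_le measure_ge0 andbT leNgt.
Qed.

Lemma Linfty_le a (c : R) : 0 <= c -> (\forall x \ae mu, rabs (a x) <= c) ->
  ('N[mu]_+oo[EFin \o (rabs \o a)] <= c%:E)%E.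
Proof.
move=> c0 ac; rewrite unlock; case: ifPn => // _; apply/ess_supP.
by apply: filterS ac => x; rewrite /= ger0_norm ?rabs_ge0.
Qed.

Lemma mulop_boundedP a : semifinite mu -> measurable_fun setT (a : T -> BK) ->
  op_bounded (mulop mu a) <-> Linfty mu a.
Proof.
move=> sf ma; split=> [[doma [C aC]]|[_ aoo]].
  (* The given bound [C] may be negative when L2 is trivial. *)
  have C0 : 0 <= Num.max C 0 by rewrite le_max lexx orbT.
  have aC1 : \forall x \ae mu, rabs (a x) <= Num.max C 0 + 1.
    apply: (@ae_le_of_mulop_le a (Num.max C 0)) => //; first by rewrite ltrDl.
    move=> f g fg f1; apply: le_trans (aC _ _ fg) _.
    apply: (@le_trans _ _ (Num.max C 0 * rnorm f)).
      by rewrite ler_wpM2r ?rnorm_ge0// le_max lexx.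
    by rewrite -[leRHS]mulr1 ler_wpM2l.
  split => //; apply: le_lt_trans (Linfty_le _ aC1) (ltry _).
  by rewrite addr_ge0.
have Nfin : 'N[mu]_+oo[EFin \o (rabs \o a)]%E \is a fin_num.
  by rewrite ge0_fin_numE ?Lnorm_ge0.
have [||doma aC] :=
    @mulop_le_of_ae_le a (fine 'N[mu]_+oo[EFin \o (rabs \o a)]%E) ma.
- by rewrite fine_ge0// Lnorm_ge0.
- by apply: filterS (Linfty_ge a) => x; rewrite -lee_fin fineK.
by split => //; exists (fine 'N[mu]_+oo[EFin \o (rabs \o a)]%E).
Qed.

(** The essential supremum bounds the operator norm by a pointwise estimate;
    the reverse inequality is [ae_le_of_mulop_le] for [c] slightly above the
    operator norm. *)
Lemma op_norm_mulop a : semifinite mu -> measurable_fun setT (a : T -> BK) ->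
  op_bounded (mulop mu a) ->
  ((op_norm (mulop mu a))%:E = 'N[mu]_+oo[EFin \o (rabs \o a)])%E.
Proof.
move=> sf ma ba; have [_ aoo] := (mulop_boundedP sf ma).1 ba.
set N := 'N[mu]_+oo[_]%E in aoo *.
have Nfin : N \is a fin_num by rewrite ge0_fin_numE ?Lnorm_ge0.
have N0 : 0 <= fine N by rewrite fine_ge0// Lnorm_ge0.
have [|doma aN] := @mulop_le_of_ae_le a (fine N) ma N0.
  by apply: filterS (Linfty_ge a) => x; rewrite -lee_fin fineK.
set S := [set r | exists f g,
  [/\ mulop mu a (f, g), rnorm f <= 1 & r = rnorm g]].
have SN : ubound S (fine N).
  move=> _ [f [g [fg f1 ->]]]; apply: le_trans (aN _ _ fg) _.
  by rewrite -[leRHS]mulr1 ler_wpM2l.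
have S0 : S 0.
  exists 0, 0; rewrite rnorm0; split => //.
  by have [] := mulop_is_operator mu a.
have hS : has_sup S by split; [exists 0 | exists (fine N)].
apply/eqP; rewrite eq_le; apply/andP; split.
  by rewrite -(fineK Nfin) lee_fin; apply: ge_sup => //; exists 0.
apply/lee_addgt0Pr => e e0; rewrite -EFinD.
have op0 : 0 <= op_norm (mulop mu a) by exact: (ub_le_sup hS.2 S0).
apply: Linfty_le; first by rewrite addr_ge0// ltW.
apply: (@ae_le_of_mulop_le a (op_norm (mulop mu a))) => //.
  by rewrite ltrDl.
by move=> f g fg f1; apply: (ub_le_sup hS.2); exists f, g.
Qed.

(** A unit vector supported where the two symbols differ and [a] is bounded would
    have an image under the first operator which is not its image under the
    second. *)
Lemma mulop_inj_ae a b : semifinite mu -> measurable_fun setT (a : T -> BK) ->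
  measurable_fun setT (b : T -> BK) ->
  mulop mu a = mulop mu b -> a = b %[ae mu].
Proof.
move=> sf ma mb ab; apply: (@ae_bounded_pieces a) => n.
pose E := [set x | rabs (a x) <= n%:R] `&` ~` [set x | a x - b x = 0].
suff : \forall x \ae mu, ~ E x.
  apply: filterS => x /not_andP nE an _.
  by case: nE => // /contrapT /= /eqP; rewrite subr_eq0 => /eqP.
apply: ae_notin_of_unit => //.
  apply: measurableI; first exact: measurable_rabs_le.
  apply: measurableC; apply: measurable_eq0; exact: measurable_scalarB.
move=> f f1 fE.
have [|g ag _] := @mulop_supported a f E n%:R ma (ler0n _ _) _ fE.
  by move=> x [].
have bg : mulop mu b (f, g) by rewrite -ab.
apply: (rnorm1_neq0 f1); near=> x.
have [Ex|] := pselect (E x); last by near: x.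
have : (a x - b x) * L2_fun f x = 0.
  by rewrite mulrBl -(near ag x)// -(near bg x)// subrr.
move=> /eqP; rewrite mulf_eq0 => /orP[/eqP abx|/eqP//].
by case: Ex => _ [].
Unshelve. all: by end_near. Qed.

End mulop_lemmas.

(** * Spectrum and resolvent *)

Section spectrum_lemmas.
Context {R : realType} {k : RorC} {V : normedModType (scalar_field R k)}.
Local Notation K := (scalar_field R k).
Implicit Types (A : set (V * V)) (x : V).

Lemma of_re_im0 : of_re_im 0 0 = 0 :> K.
Proof. by case: k. Qed.

Lemma rnormK x : of_re_im (rnorm x) 0 = `|x|.
Proof.
have : 0 <= `|x| := normr_ge0 x; rewrite /rnorm.
case: k V x => W x //=; case: `|x| => u v /=.
by rewrite lecE /= => /andP[/eqP -> _].
Qed.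

Lemma cvg_rnorm0P (y : nat -> V) :
  y @ \oo --> (0 : V) <->
  forall e : R, 0 < e -> \forall n \near \oo, rnorm (y n) < e.
Proof.
split=> [/cvgr0Pnorm_lt y0 e e0|y0].
  have : (0 : K) < of_re_im e 0 by rewrite -of_re_im0 lt_of_re_im.
  move=> /y0; apply: filterS => n.
  by rewrite -rnormK lt_of_re_im.
apply/cvgr0Pnorm_lt => _ /gt0_of_re_im[e e0 ->].
by apply: filterS (y0 e e0) => n; rewrite -rnormK lt_of_re_im.
Qed.

(** A bounded inverse cannot send vectors tending to [0] to unit vectors. *)
Lemma approx_point_spectrum_sub A : approx_point_spectrum A `<=` spectrum A.
Proof.
move=> l [x [y [xy x1 /cvg_rnorm0P y0]]] [_ [_ [C bC]]].
have D0 : 0 < `|C| + 1 by rewrite ltr_wpDl.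
have : 0 < (`|C| + 1)^-1 by rewrite invr_gt0.
move=> /y0[N _ /(_ N (leqnn N)) /=]; apply/negP; rewrite -leNgt.
rewrite -[leLHS]mul1r ler_pdivrMr// -[leLHS](x1 N).
apply: (le_trans (bC _ _ (xy N))).
have y0N : 0 <= rnorm (y N).
  by rewrite -(@ler_of_re_im R k) of_re_im0 rnormK.
by rewrite mulrC ler_wpM2l// (le_trans (ler_norm C))// lerDl.
Qed.

End spectrum_lemmas.

Section mulop_spectrum.
Context {d} {T : measurableType d} {R : realType} {k : RorC}.
Variable mu : {measure set T -> \bar R}.
Local Notation K := (scalar_field R k).
Local Notation BK := (borel_scalar R k).
Local Notation L2 := (L2 mu k).
Implicit Types (f g h : L2) (a b : T -> K) (E : set T).

Lemma op_shift_mulop (l : K) a :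
  op_shift l (mulop mu a) = mulop mu (fun x => l - a x).
Proof.
have sub (f g : L2) (c : T -> K) : mulop mu c (f, g) ->
    mulop mu (fun x => l - c x) (f, l *: f - g).
  move=> fg; have e1 := L2_funD (l *: f) (- g); have e2 := L2_funZ l f.
  have e3 := L2_funZ (-1) g; rewrite scaleN1r in e3.
  rewrite /mulop /=; near=> x => _.
  rewrite (near e1 x)// (near e2 x)// (near e3 x)// (near fg x)//=.
  by rewrite mulN1r mulrBl.
apply/seteqP; split => -[f g] /=.
  by rewrite /op_shift /= => -[h fh ->]; exact: sub.
move=> /sub fg; exists (l *: f - g); last by rewrite opprB addrC subrK.
rewrite /mulop /= in fg *; apply: filterS fg => x /(_ I) -> _.
by rewrite opprB addrC subrK.
Unshelve. all: by end_near. Qed.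

Lemma measurable_shift (l : K) a : measurable_fun setT (a : T -> BK) ->
  measurable_fun setT ((fun x => l - a x) : T -> BK).
Proof. by move=> ma; exact: measurable_scalarB. Qed.

(** Off the essential range, [l - a] stays away from [0] almost everywhere, and
    multiplication by its inverse is a bounded inverse operator. *)
Lemma spectrum_sub_essran a : measurable_fun setT (a : T -> BK) ->
  spectrum (mulop mu a) `<=` essran mu a.
Proof.
move=> ma l sl e e0; rewrite lt0e measure_ge0 andbT.
apply/eqP => mu0; apply: sl.
have mE : measurable [set x | rabs (a x - l) <= e].
  apply: measurable_rabs_le; exact: measurable_scalarB.
have lae : \forall x \ae mu, e < rabs (l - a x).
  apply: filterS ((measure0_aeP mu mE).1 mu0) => x /= /negP.
  by rewrite -ltNge -rabsN opprB.
have la0 : \forall x \ae mu, l - a x <> 0.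
  apply: filterS lae => x + lax.
  by rewrite lax rabs0 => /(lt_trans e0); rewrite ltxx.
rewrite /resolvent_set /= op_shift_mulop; split.
  exact: mulop_inj_of_neq0.
rewrite op_inv_mulop//.
have [|||dom bd] := @mulop_le_of_ae_le _ _ _ _ mu (fun x => (l - a x)^-1) e^-1.
- exact/measurable_scalarV/measurable_shift.
- by rewrite invr_ge0 ltW.
- apply: filterS lae => x lax; rewrite rabsV lef_pV2 ?posrE// ?ltW//.
  exact: lt_trans lax.
by split => //; exists e^-1.
Qed.

(** Unit vectors supported where [rabs (a x - l)] is at most [n.+1%:R^-1] are
    approximate eigenvectors. *)
Lemma essran_sub_approx a : semifinite mu ->
  measurable_fun setT (a : T -> BK) ->
  essran mu a `<=` approx_point_spectrum (mulop mu a).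
Proof.
move=> sf ma l la.
have /choice[xy xyP] : forall n : nat, exists xy : L2 * L2,
    [/\ op_shift l (mulop mu a) xy, rnorm xy.1 = 1 & rnorm xy.2 <= n.+1%:R^-1].
  move=> n; have n0 : 0 < n.+1%:R^-1 :> R by rewrite invr_gt0.
  pose E := [set x | rabs (a x - l) <= n.+1%:R^-1].
  have mE : measurable E.
    apply: measurable_rabs_le; exact: measurable_scalarB.
  have [f f1 fE] := @unit_supported _ _ _ k _ _ sf mE (la _ n0).
  have [|g fg gn] := mulop_supported (measurable_shift l ma) (ltW n0) _ fE.
    by move=> x; rewrite /E /= -rabsN opprB.
  exists (f, g); split => //=.
    by rewrite op_shift_mulop.
  by rewrite f1 mulr1 in gn.
exists (fun n => (xy n).1), (fun n => (xy n).2); split.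
- by move=> n; have [] := xyP n; case: (xy n).
- by move=> n; have [] := xyP n.
apply/cvg_rnorm0P => e e0; near=> n.
have [_ _ /le_lt_trans] := xyP n; apply.
by near: n; exact: near_infty_natSinv_lt (PosNum e0).
Unshelve. all: by end_near. Qed.

Lemma resolvent_mulop (l : K) a : semifinite mu ->
  measurable_fun setT (a : T -> BK) -> resolvent_set (mulop mu a) l ->
  resolvent l (mulop mu a) = mulop mu (fun x => (l - a x)^-1).
Proof.
move=> sf ma [+ _]; rewrite /resolvent op_shift_mulop.
by move=> /(mulop_injP sf (measurable_shift l ma)); exact: op_inv_mulop.
Qed.

End mulop_spectrum.

(** * Symmetry and self-adjointness *)

Section inner_product.
Context {d} {T : measurableType d} {R : realType} {k : RorC}.
Variable mu : {measure set T -> \bar R}.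
Local Notation K := (scalar_field R k).
Local Notation BK := (borel_scalar R k).
Local Notation L2 := (L2 mu k).
Local Notation inner := (L2_inner mu k).
Implicit Types (f g h : L2) (a b : T -> K) (E : set T).

Lemma integrable_rabs_sq f :
  mu.-integrable setT (fun x => (rabs (L2_fun f x) ^+ 2)%:E).
Proof.
apply/integrableP; split.
  apply/measurable_EFinP; apply: measurable_funX.
  exact/measurable_rabs_comp/L2_fun_measurable.
under eq_integral => x _ do rewrite gee0_abs ?lee_fin ?sqr_ge0//.
by rewrite -rnorm_sq ltry.
Qed.

Let measurable_inner f g : measurable_fun setT
  ((fun x => L2_fun f x * conj (L2_fun g x)) : T -> BK).
Proof.
apply: measurable_scalarM; first exact: L2_fun_measurable.
exact/measurable_scalar_conj/L2_fun_measurable.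
Qed.

(** The real part of the inner product already determines the norm
    ([re_inner_self]), so the argument runs over integrals of real parts. *)
Lemma integrable_re_inner f g :
  mu.-integrable setT (EFin \o (fun x => re (L2_fun f x * conj (L2_fun g x)))).
Proof.
apply: (le_integrable measurableT _ _
  (integrableD measurableT (integrable_rabs_sq f) (integrable_rabs_sq g))).
  by apply/measurable_EFinP; have /measurable_scalarP[] := measurable_inner f g.
move=> x _; rewrite /= lee_fin [leRHS]ger0_norm ?addr_ge0 ?sqr_ge0//.
apply: (le_trans (re_le_rabs _)); rewrite rabsM rabs_conj.
have := sqr_ge0 (rabs (L2_fun f x) - rabs (L2_fun g x)).
have := mulr_ge0 (rabs_ge0 (L2_fun f x)) (rabs_ge0 (L2_fun g x)).
by nra.
Qed.

Lemma ae_eq_Rintegral (u v : T -> R) :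
  measurable_fun setT u -> measurable_fun setT v ->
  (\forall x \ae mu, u x = v x) -> \int[mu]_x u x = \int[mu]_x v x.
Proof.
move=> meas_u meas_v uv; rewrite /Rintegral; congr fine.
apply: ae_eq_integral => //.
- exact/measurable_EFinP.
- exact/measurable_EFinP.
by apply: filterS uv => x -> _.
Qed.

Lemma eq_L2_inner f g f' g' :
  (\forall x \ae mu, L2_fun f x * conj (L2_fun g x) =
                     L2_fun f' x * conj (L2_fun g' x)) ->
  inner f g = inner f' g'.
Proof.
move=> eqfg; have /measurable_scalarP[? ?] := measurable_inner f g.
have /measurable_scalarP[? ?] := measurable_inner f' g'.
rewrite /L2_inner; congr of_re_im; apply: ae_eq_Rintegral => //;
  by apply: filterS eqfg => x ->.
Qed.

Lemma re_innerBr f g h : re (inner f (g - h)) = re (inner f g) - re (inner f h).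
Proof.
rewrite !re_of_re_im -RintegralB ?integrable_re_inner//.
have /measurable_scalarP[m1 _] := measurable_inner f (g - h).
have /measurable_scalarP[m2 _] := measurable_inner f g.
have /measurable_scalarP[m3 _] := measurable_inner f h.
apply: ae_eq_Rintegral => //; first exact: measurable_funB.
have e1 := L2_funD g (- h); have e2 := L2_funZ (-1) h; rewrite scaleN1r in e2.
apply: filterS2 e1 e2 => x /(_ I) -> /(_ I) ->.
rewrite !reM !re_conj !im_conj !reD !imD mulN1r reN imN.
by ring.
Qed.

Lemma re_inner_self f : re (inner f f) = rnorm f ^+ 2.
Proof.
apply: EFin_inj; rewrite rnorm_sq re_of_re_im /Rintegral fineK.
  by apply: eq_integral => x _; rewrite reM re_conj im_conj rabs_sq mulrN opprK.
have := integrable_re_inner f f; exact: integrable_fin_num.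
Qed.

(** The difference of the two inner products is the squared norm of [g - h]. *)
Lemma eq_of_inner_sub g h : inner (g - h) g = inner (g - h) h -> g = h.
Proof.
move=> gh; apply/eqP; rewrite -subr_eq0; apply/eqP; apply: rnorm_eq0.
have := re_innerBr (g - h) g h; rewrite gh subrr re_inner_self => /eqP.
by rewrite expf_eq0 => /andP[_ /eqP].
Qed.

Lemma cutoff f E : measurable E ->
  exists2 g, mulop mu (\1_E : T -> K) (f, g) &
             \forall x \ae mu, ~ E x -> L2_fun g x = 0.
Proof.
move=> mE.
have c1 x : rabs (\1_E x : K) <= 1 by exact: rabs_indic_le1.
have [dom _] := mulop_le_of_ae_le (measurable_scalar_indic mE) ler01 (aeW mu c1).
have [g fg] : op_dom (mulop mu (\1_E : T -> K)) f by rewrite dom.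
exists g => //; apply: filterS fg => x /(_ I) /= -> Ex.
by rewrite indicE memNset// mul0r.
Qed.

(** The cutoffs of [f] to the sublevel sets of [rabs \o a] lie in the domain and
    converge to [f] by dominated convergence. *)
Lemma mulop_dom_dense a : measurable_fun setT (a : T -> BK) ->
  dense (op_dom (mulop mu a)).
Proof.
move=> ma O [f Of] oO.
pose E n := [set x | rabs (a x) <= n%:R].
have mE n : measurable (E n) by exact: measurable_rabs_le.
pose c n x : K := \1_(E n) x.
have mc n : measurable_fun setT (c n : T -> BK).
  by exact: measurable_scalar_indic.
have /choice[g gP] n : exists g, mulop mu (c n) (f, g) /\
    \forall x \ae mu, ~ E n x -> L2_fun g x = 0.
  by have [g] := cutoff f (mE n); exists g.
have gdom n : op_dom (mulop mu a) (g n).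
  have [|h gh _] := mulop_supported ma (ler0n _ n) _ (gP n).2; first by [].
  by exists h.
have g_f : (f - g n) @[n --> \oo] --> (0 : L2).
  apply/cvg_rnorm0P => e e0.
  pose F n x := (rabs ((1 - c n x) * L2_fun f x) ^+ 2)%:E.
  have normF n : ((rnorm (f - g n) ^+ 2)%:E = \int[mu]_x F n x)%E.
    rewrite rnorm_sq; apply: ge0_ae_eq_integral => //.
    - apply/measurable_EFinP; apply: measurable_funX.
      exact/measurable_rabs_comp/L2_fun_measurable.
    - apply/measurable_EFinP; apply: measurable_funX.
      apply: measurable_rabs_comp.
      apply: measurable_scalarM; last exact: L2_fun_measurable.
      exact: measurable_shift.
    - by move=> x _; rewrite lee_fin sqr_ge0.
    - by move=> x _; rewrite lee_fin sqr_ge0.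
    have e1 := L2_funD f (- g n); have e2 := L2_funZ (-1) (g n).
    rewrite scaleN1r in e2; near=> x => _.
    rewrite (near e1 x)// (near e2 x)// (near (gP n).1 x)//= /F.
    by rewrite mulN1r mulrBl mul1r.
  have [|||||_ _] := @dominated_convergence _ _ _ mu setT measurableT
     F (cst 0%E) (fun x => (rabs (L2_fun f x) ^+ 2)%:E).
  - move=> n; apply/measurable_EFinP; apply: measurable_funX.
    apply: measurable_rabs_comp.
    apply: measurable_scalarM; last exact: L2_fun_measurable.
    exact: measurable_shift.
  - exact: measurable_cst.
  - apply: nearW => x _; apply: cvg_near_cst; near=> n.
    rewrite /F /c indicE mem_set ?subrr ?mul0r ?rabs0 ?expr0n//.
    rewrite /E /=; apply: ltW; near: n; exact: nbhs_infty_gtr.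
  - exact: integrable_rabs_sq.
  - apply: nearW => x n _; rewrite /F gee0_abs ?lee_fin ?sqr_ge0//.
    rewrite ler_sqr ?nnegrE ?rabs_ge0// rabsM ler_piMl ?rabs_ge0//.
    rewrite /c indicE /rabs; case: (_ \in _).
      by rewrite subrr normr0; case: (k) => /=.
    by rewrite subr0 normr1; case: (k) => /=.
  rewrite integral0 => /fine_cvgP[_ /cvgr0Pnorm_lt F0].
  have := F0 _ (exprn_gt0 2 e0); apply: filterS => n /=.
  rewrite -normF /= ger0_norm ?sqr_ge0// ltr_sqr// ?nnegrE ?rnorm_ge0//.
  exact: ltW.
have : g @ \oo --> f.
  have -> : g = (fun n => f - (f - g n)).
    by apply/funext => n; rewrite opprB addrC subrK.
  by rewrite -[f in _ --> f]subr0; apply: cvgB => //; exact: cvg_cst.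
have nO : nbhs f O by apply: open_nbhs_nbhs; split.
move=> /(_ O nO) [N _ /(_ N (leqnn N)) ON].
by exists (g N); split.
Unshelve. all: by end_near. Qed.

(** For [f] supported where [a] is bounded and not real, symmetry tested on [f]
    and [h = (a - conj a) f] says that [a f] and [conj a f] have the same inner
    product with their difference [h]; hence [h = 0] and so [f = 0]. *)
Lemma symmetric_real a : semifinite mu -> measurable_fun setT (a : T -> BK) ->
  op_symmetric inner (mulop mu a) -> \forall x \ae mu, im (a x) = 0.
Proof.
move=> sf ma [_ syma]; apply: (@ae_bounded_pieces _ _ _ _ mu a) => n.
have mca := measurable_scalar_conj ma.
pose s x := a x - conj (a x).
have ms : measurable_fun setT (s : T -> BK) by exact: measurable_scalarB.
pose E := [set x | rabs (a x) <= n%:R] `&` ~` [set x | s x = 0].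
suff : \forall x \ae mu, ~ E x.
  apply: filterS => x /not_andP nE an.
  case: nE => // /contrapT /= /(congr1 im).
  by rewrite /s imD imN im_conj opprK im0 => ?; lra.
apply: ae_notin_of_unit => //.
  apply: measurableI; first exact: measurable_rabs_le.
  apply: measurableC; exact: measurable_eq0.
move=> f f1 fE.
have [|y fy _] := mulop_supported ma (ler0n _ n) _ fE; first by move=> x [].
have [|p fp _] := mulop_supported mca (ler0n _ n) _ fE.
  by move=> x []; rewrite /= rabs_conj.
pose h := y - p.
have fh : mulop mu s (f, h).
  have e1 := L2_funD y (- p); have e2 := L2_funZ (-1) p.
  rewrite scaleN1r in e2; rewrite /mulop /=; near=> x => _.
  rewrite (near e1 x)// (near e2 x)// (near fy x)// (near fp x)//=.
  by rewrite mulN1r mulrBl.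
have hE : \forall x \ae mu, ~ E x -> L2_fun h x = 0.
  by apply: filterS2 fE fh => x fx /(_ I) /= -> /fx ->; rewrite mulr0.
have [|q hq _] := mulop_supported ma (ler0n _ n) _ hE; first by move=> x [].
(* With [q = a h]: pointwise [q * conj f = h * conj p], since [p = conj a f]. *)
have yp : y = p.
  apply: eq_of_inner_sub; rewrite -/h -(syma _ _ _ _ hq fy).
  apply: eq_L2_inner; apply: filterS2 hq fp => x /(_ I) /= -> /(_ I) /= ->.
  apply: re_im_inj; rewrite !(reM, imM, re_conj, im_conj); ring.
have h0 : h = 0 by rewrite /h yp subrr.
apply: (rnorm1_neq0 f1); rewrite h0 in fh; have e0 := L2_fun0 mu k; near=> x.
have [Ex|] := pselect (E x); last by near: x.
have /eqP : s x * L2_fun f x = 0 by rewrite -(near fh x)// (near e0 x).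
rewrite mulf_eq0 => /orP[/eqP sx|/eqP//].
by case: Ex => _ [].
Unshelve. all: by end_near. Qed.

(** For the inclusion of the adjoint, let [(g, h)] belong to it and cut [a g]
    and [h] off to a set [E] where [a] is bounded, giving [p] and [q]. As
    [p - q] is supported in [E], it is in the domain, and testing the adjoint
    relation on it yields [inner (p - q) p = inner (p - q) q], so [p = q]. *)
Lemma real_selfadjoint a : measurable_fun setT (a : T -> BK) ->
  (\forall x \ae mu, im (a x) = 0) -> op_selfadjoint inner (mulop mu a).
Proof.
move=> ma ima; split; first exact: mulop_dom_dense.
apply/seteqP; split => -[g h] /=.
  move=> gh f y fy; apply: eq_L2_inner; near=> x.
  rewrite (near fy x)// (near gh x)//=.
  have ax : im (a x) = 0 by near: x.
  by apply: re_im_inj; rewrite !(reM, imM, re_conj, im_conj) ax; ring.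
move=> adj; rewrite /mulop /=.
suff : \forall x \ae mu, L2_fun h x = a x * L2_fun g x.
  by apply: filterS => x ->.
apply: (@ae_bounded_pieces _ _ _ _ mu a) => n.
pose E := [set x | rabs (a x) <= n%:R].
have mE : measurable E by exact: measurable_rabs_le.
have cE x : E x -> \1_E x = 1 :> K by move=> Ex; rewrite indicE mem_set.
have cN x : ~ E x -> \1_E x = 0 :> K by move=> Ex; rewrite indicE memNset.
have [g' gg' g'E] := cutoff g mE; have [q hq _] := cutoff h mE.
have [|p g'p _] := mulop_supported ma (ler0n _ n) _ g'E; first by [].
have e1 := L2_funD p (- q); have e2 := L2_funZ (-1) q.
rewrite scaleN1r in e2.
have e1x : \forall x \ae mu, L2_fun (p - q) x =
    \1_E x * (a x * L2_fun g x - L2_fun h x).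
  near=> x; rewrite (near e1 x)// (near e2 x)// (near g'p x)//=.
  by rewrite (near gg' x)// (near hq x)//=; ring.
have rE : \forall x \ae mu, ~ E x -> L2_fun (p - q) x = 0.
  by apply: filterS e1x => x -> /cN ->; rewrite mul0r.
have [|y ry _] := mulop_supported ma (ler0n _ n) _ rE; first by [].
have pq : p = q.
  apply: eq_of_inner_sub; transitivity (inner y g).
    apply: eq_L2_inner; near=> x.
    rewrite (near ry x)//= (near g'p x)//= (near gg' x)//=.
    have [Ex|Ex] := pselect (E x); last first.
      by have -> : L2_fun (p - q) x = 0;
        [move: Ex; near: x|rewrite !(mulr0,mul0r)].
    have ax : im (a x) = 0 by near: x.
    rewrite (cE _ Ex) mul1r.
    by apply: re_im_inj; rewrite !(reM, imM, re_conj, im_conj) ax; ring.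
  rewrite (adj _ _ ry); apply: eq_L2_inner; near=> x.
  have [Ex|Ex] := pselect (E x); last first.
    by have -> : L2_fun (p - q) x = 0; [move: Ex; near: x|rewrite !mul0r].
  by rewrite (near hq x)//= (cE _ Ex) mul1r.
rewrite pq subrr in e1x; have e0 := L2_fun0 mu k; near=> x => Ex.
have : \1_E x * (a x * L2_fun g x - L2_fun h x) = 0.
  by rewrite -(near e1x x)// (near e0 x).
by rewrite (cE _ Ex) mul1r => /eqP; rewrite subr_eq0 => /eqP.
Unshelve. all: by end_near. Qed.

End inner_product.

(** * The theorem *)

Theorem corollary4p6 (R : realType) (k : RorC) (d : measure_display)
    (T : measurableType d) (mu : {measure set T -> \bar R})
    (mu_semifinite : semifinite mu) (a : T -> scalar_field R k)
    (a_meas : measurable_fun setT (a : T -> borel_scalar R k)) :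
  (* a *)
  ((op_inj (mulop mu a) <-> mu [set x | a x = 0] = 0%E) /\
   (op_inj (mulop mu a) ->
      op_inv (mulop mu a) = mulop mu (fun x => (a x)^-1))) /\
  (* b *)
  ((op_bounded (mulop mu a) <-> Linfty mu a) /\
   (op_bounded (mulop mu a) ->
      (op_norm (mulop mu a))%:E = ('N[mu]_+oo[EFin \o (rabs \o a)])%E)) /\
  (* c *)
  (spectrum (mulop mu a) = approx_point_spectrum (mulop mu a) /\
   approx_point_spectrum (mulop mu a) = essran mu a) /\
  (* d *)
  (forall lambda : scalar_field R k, resolvent_set (mulop mu a) lambda ->
     resolvent lambda (mulop mu a) = mulop mu (fun x => (lambda - a x)^-1)) /\
  (* e *)
  (forall b : T -> scalar_field R k,
     measurable_fun setT (b : T -> borel_scalar R k) ->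
     mulop mu a = mulop mu b -> a = b %[ae mu]) /\
  (* f *)
  ((op_symmetric (L2_inner mu k) (mulop mu a) <->
      op_selfadjoint (L2_inner mu k) (mulop mu a)) /\
   (op_selfadjoint (L2_inner mu k) (mulop mu a) <->
      {ae mu, forall x, im (a x) = 0})).
Proof.
have aP : (\forall x \ae mu, a x <> 0) <-> mu [set x | a x = 0] = 0%E.
  by apply: iff_sym; exact: measure0_aeP (measurable_eq0 a_meas).
have injP := mulop_injP mu_semifinite a_meas.
have ess_ap := essran_sub_approx mu_semifinite a_meas.
have ap_sp := @approx_point_spectrum_sub R k _ (mulop mu a).
have sp_ess := @spectrum_sub_essran _ _ _ _ mu a a_meas.
have symR := symmetric_real mu_semifinite a_meas.
have selfR := @real_selfadjoint _ _ _ _ mu a a_meas.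
have self_sym : op_selfadjoint (L2_inner mu k) (mulop mu a) ->
    op_symmetric (L2_inner mu k) (mulop mu a).
  by move=> [dom self]; split => // f y g h fy; rewrite self => /(_ _ _ fy).
split; [|split; [|split; [|split; [|split]]]].
- split; first exact: iff_trans injP aP.
  by move/injP; exact: op_inv_mulop.
- split; first exact: mulop_boundedP.
  exact: op_norm_mulop.
- split; apply/seteqP; split => // l; first by move=> /sp_ess/ess_ap.
  by move=> /ap_sp/sp_ess.
- by move=> l; exact: resolvent_mulop.
- by move=> b b_meas; exact: mulop_inj_ae.
- split; split => //; first by move=> /symR/selfR.
  by move=> /self_sym/symR.
Qed.
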